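(* (a) There exist graphs $G$ with $O_{R,k}(G)=\mathcal{M}$ for all positive integers $k$. (b) There exist graphs $G$ with $O_{R,k}(G)=\mathcal{N}$ for all positive integers $k$. (c) There exist graphs $G$ with $O_{R,k}(G)=\mathcal{B}$ for all positive integers $k$. (d) There exists a graph $G$ with $O_{R,1}(G)=\mathcal{N}$ and $O_{R,k}(G)=\mathcal{M}$ for all $k\ge 2$. (e) There exist graphs $G$ with $O_{R,1}(G)=\mathcal{B}$ and $O_{R,k}(G)=\mathcal{N}$ for all $k\ge2$. (f) There exist graphs $G$ with $O_{R,1}(G)=\mathcal{B}$ and $O_{R,k}(G)=\mathcal{M}$ for all $k\ge2$. (g) For every integer $\alpha\ge2$, let $G$ be the graph obtained from a path $v_1v_2\cdots v_\alpha$ as follows: for each $i\in\{1,\dots,\alpha\}$ add two leaves $\ell_i,\ell'_i$ adjacent to $v_i$, and add three vertices $s_i,s'_i,x_i$ with edges $v_is_i$, $v_is'_i$, $s_ix_i$, $s'_ix_i$; then add a vertex $y$ adjacent to all of $x_1,\dots,x_\alpha$ and a vertex $z$ adjacent only to $y$. Then $O_{R,1}(G)=\mathcal{B}$, $O_{R,2}(G)=\mathcal{N}$, and $O_{R,k}(G)=\mathcal{M}$ for all $k\ge3$. In particular, there exist graphs $G$ with $O_{R,1}(G)=\mathcal{B}$, $O_{R,2}(G)=\mathcal{N}$ and $O_{R,k}(G)=\mathcal{M}$ for $k\ge3$.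
   Context: All graphs are finite, simple, undirected and connected. $d$ is the shortest-path distance and $d_k(x,y)=\min\{d(x,y),k+1\}$ for a positive integer $k$. A set $S\subseteq V(G)$ is a distance-$k$ resolving set if for all distinct $x,y\in V(G)$ some $z\in S$ has $d_k(x,z)\ne d_k(y,z)$. In the Maker-Breaker distance-$k$ resolving game on $G$, Maker and Breaker alternately select a not-yet-chosen vertex; Maker wins if his selected vertices form a distance-$k$ resolving set, Breaker wins otherwise. $O_{R,k}(G)=\mathcal{M}$ if Maker has a winning strategy whether he moves first or second, $\mathcal{B}$ if Breaker has a winning strategy whether she moves first or second, and $\mathcal{N}$ if the first player has a winning strategy. *)

(* Defs.v *)
From mathcomp Require Import all_boot.
Set Implicit Arguments. Unset Strict Implicit. Unset Printing Implicit Defensive.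

Section Graphs.
Variable T : finType.
Variable e : rel T.

Definition simple_connected_graph : Prop :=
  [/\ symmetric e, irreflexive e & forall x y : T, connect e x y].

Fixpoint ball (n : nat) (x : T) : {set T} :=
  if n is n'.+1 then
    ball n' x :|: [set y | [exists z in ball n' x, e z y]]
  else [set x].

(* shortest-path distance: least n with y in ball n x (in a connected graph
   the distance is < #|T|, so searching 0..#|T|-1 suffices) *)
Definition dist (x y : T) : nat :=
  find (fun n => y \in ball n x) (iota 0 #|T|).

Definition distk (k : nat) (x y : T) : nat := minn (dist x y) k.+1.

Definition resolving (k : nat) (S : {set T}) : bool :=
  [forall x, forall y, (x != y) ==>
     [exists z in S, distk k x z != distk k y z]].

(* maker_wins k n mturn M B: from the position where Maker holds M, Breaker
   holds B, and it is Maker's turn iff mturn, Maker can force that at the end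
   of the game (all vertices selected) his vertices form a distance-k
   resolving set.  n is fuel, instantiated with #|T| >= number of free
   vertices. *)
Fixpoint maker_wins (k n : nat) (mturn : bool) (M B : {set T}) : bool :=
  if n is n'.+1 then
    if [set: T] \subset M :|: B then resolving k M
    else if mturn then
      [exists v, (v \notin M :|: B) && maker_wins k n' false (v |: M) B]
    else
      [forall v, (v \notin M :|: B) ==> maker_wins k n' true M (v |: B)]
  else resolving k M.

Definition maker_first_wins (k : nat) : bool :=
  maker_wins k #|T| true set0 set0.
Definition maker_second_wins (k : nat) : bool :=
  maker_wins k #|T| false set0 set0.

End Graphs.

Inductive outcome := OM | ON | OB | OSecond.

Definition O_R (T : finType) (e : rel T) (k : nat) : outcome :=
  match maker_first_wins e k, maker_second_wins e k with
  | true, true => OM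
  | true, false => ON
  | false, false => OB
  | false, true => OSecond
  end.

(* The graph of part (g).  Vertices: inl (i, t) with i : 'I_alpha indexing
   v_{i+1} and t = 0,1,2,3,4,5 standing for v_i, l_i, l'_i, s_i, s'_i, x_i;
   inr true = y, inr false = z. *)
Definition gV (alpha : nat) : finType := ('I_alpha * 'I_6 + bool)%type.

Definition g_base (alpha : nat) (a b : gV alpha) : bool :=
  match a, b with
  | inl (i, t), inl (j, u) =>
      [|| [&& t == 0 :> nat, u == 0 :> nat & (i.+1 == j) ],
          [&& t == 0 :> nat, (1 <= u <= 4) & i == j ] |
          [&& (3 <= t <= 4), u == 5 :> nat & i == j ] ]
  | inl (_, t), inr true => t == 5 :> nat
  | inr true, inr false => true
  | _, _ => false
  end.

Definition g_adj (alpha : nat) : rel (gV alpha) :=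
  fun a b => g_base a b || g_base b a.

(* Main.v *)
Require Import Defs.
From mathcomp Require Import all_boot.
From mathcomp Require Import zify.

(** Parts (a)-(f) are witnessed by graphs on at most eight vertices and diameter
at most three, so that [d_k] no longer depends on [k >= 2]; their games are
evaluated as positional games on the hypergraph whose edges are the sets of
vertices distinguishing two given vertices.

In the graph of part (g), leaf and side twins force Maker to take one vertex of
each pair [l_i, l'_i] and [s_i, s'_i]. What is left is to distinguish the other
leaf from the other side vertex in each gadget. For [k = 1] only [x_i] does so,
for [k = 2] only [x_i] and [y], and for [k >= 3] also [z]. Breaker therefore
wins by forcing twin replies in a gadget that Maker has not touched and then
taking [x_i], provided that [k = 1] or that she owns [y] and [k = 2]; otherwise
Maker gets one of [y], [z] and follows the pairing strategy. *)

Set Implicit Arguments. Unset Strict Implicit. Unset Printing Implicit Defensive.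

Lemma disjointsU1l (T : finType) (x : T) (A B : {set T}) :
  [disjoint x |: A & B] = (x \notin B) && [disjoint A & B].
Proof. by rewrite !disjoints_subset subUset sub1set inE. Qed.

Lemma disjointsU1r (T : finType) (x : T) (A B : {set T}) :
  [disjoint A & x |: B] = (x \notin A) && [disjoint A & B].
Proof. by rewrite disjoint_sym disjointsU1l disjoint_sym. Qed.

(** * Positions, Breaker's threats and Maker's pairing strategies *)

Section Game.
Variables (T : finType) (e : rel T) (k : nat).
Implicit Types (M B S D : {set T}) (b : bool).

(** With the fuel tied to the number of free vertices, the outcome depends on the position alone,
    and the recursion equations below carry no counter. *)
Definition win b M B : bool := maker_wins e k #|~: (M :|: B)| b M B.

Lemma maker_first_winsE : maker_first_wins e k = win true set0 set0.
Proof. by rewrite /maker_first_wins /win setU0 setC0 cardsT. Qed.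

Lemma maker_second_winsE : maker_second_wins e k = win false set0 set0.
Proof. by rewrite /maker_second_wins /win setU0 setC0 cardsT. Qed.

Lemma win_over b M B : M :|: B = setT -> win b M B = resolving e k M.
Proof. by move=> MB; rewrite /win MB setCT cards0. Qed.

Lemma card_free (M B : {set T}) v : v \notin M :|: B ->
  #|~: (M :|: B)| = #|~: ((v |: M) :|: B)|.+1.
Proof.
move=> vF; rewrite (cardsD1 v) in_setC vF add1n; congr _.+1.
by apply: eq_card => w; rewrite !inE !negb_or andbA.
Qed.

Lemma win_maker M B v : v \notin M :|: B ->
  win true M B = [exists v, (v \notin M :|: B) && win false (v |: M) B].
Proof.
move=> vF; rewrite /win (card_free vF) /= ifF; last first.
  by apply/negP => /subsetP /(_ v (in_setT v)); rewrite (negPf vF).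
apply: eq_existsb => w; case wF: (w \notin _) => //=.
by have := card_free wF; rewrite (card_free vF) => -[->].
Qed.

Lemma win_breaker M B v : v \notin M :|: B ->
  win false M B = [forall v, (v \notin M :|: B) ==> win true M (v |: B)].
Proof.
move=> vF; rewrite /win (card_free vF) /= ifF; last first.
  by apply/negP => /subsetP /(_ v (in_setT v)); rewrite (negPf vF).
apply: eq_forallb => w; case wF: (w \notin _) => //=.
by have := card_free wF; rewrite (card_free vF) setUCA setUA => -[->].
Qed.

(** Induction on the number of free vertices. The vertex [v] in the two step cases only testifies
    that the game is not over. *)
Lemma win_ind (P : bool -> {set T} -> {set T} -> Prop) :
  (forall b M B, M :|: B = setT -> P b M B) ->
  (forall M B v, v \notin M :|: B ->
     (forall w, w \notin M :|: B -> P false (w |: M) B) -> P true M B) ->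
  (forall M B v, v \notin M :|: B ->
     (forall w, w \notin M :|: B -> P true M (w |: B)) -> P false M B) ->
  forall b M B, P b M B.
Proof.
move=> P0 Pm Pb b M B; have [n le_n] := ubnP #|~: (M :|: B)|.
elim: n b M B le_n => // n IHn b M B le_n.
have [F0|[v]] := set_0Vmem (~: (M :|: B)).
  by apply: P0; rewrite -[LHS]setCK F0 setC0.
rewrite in_setC => vF; case: b; [apply: (Pm _ _ v) | apply: (Pb _ _ v)] => // w wF.
  by apply: IHn; rewrite (card_free wF) in le_n.
by apply: IHn; rewrite (card_free wF) -setUA setUCA in le_n.
Qed.

Lemma resolvingP S : reflect
  (forall x y, x != y -> exists2 z, z \in S & distk e k x z != distk e k y z)
  (resolving e k S).
Proof.
apply: (iffP forallP) => [H x y xy|H x].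
  by have /forallP/(_ y)/implyP/(_ xy)/exists_inP := H x.
by apply/forallP => y; apply/implyP => /H /exists_inP.
Qed.

Lemma unresolved S x y : x != y ->
  {in S, forall z, distk e k x z = distk e k y z} -> ~~ resolving e k S.
Proof.
by move=> xy H; apply/resolvingP => /(_ x y xy) [z /H ->]; rewrite eqxx.
Qed.

(** These are Breaker's winning sets in the sense of positional games: once she owns one entirely,
    Maker's final set misses it. *)
Definition spoils (D : {set T}) :=
  forall S, [disjoint S & D] -> ~~ resolving e k S.

Lemma breaker_done b M B D : [disjoint M & B] -> D \subset B -> spoils D ->
  ~~ win b M B.
Proof.
move=> MB DB sD; move: MB DB.
move: b M B; apply: win_ind => [b M B full|M B v vF IH|M B v vF IH] MB DB.
- by rewrite win_over //; apply: sD; apply: disjointWr DB MB.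
- rewrite (win_maker vF); apply/existsPn => w; rewrite negb_and negbK.
  case wF: (w \in _) => //=; apply: IH => //; rewrite ?wF //.
  by rewrite disjointsU1l MB andbT; move: wF; rewrite inE => /norP[].
- rewrite (win_breaker vF); apply/forallPn; exists v; rewrite vF /=.
  apply: IH => //; last by rewrite subsetU // DB orbT.
  by rewrite disjointsU1r MB andbT; move: vF; rewrite inE => /norP[].
Qed.

Lemma breaker_moves v M B : v \notin M :|: B ->
  ~~ win true M (v |: B) -> ~~ win false M B.
Proof.
move=> vF H; rewrite (win_breaker vF); apply/forallPn; exists v.
by rewrite vF.
Qed.

Lemma maker_moves u M B : u \notin M :|: B ->
  (forall v, v \notin M :|: B -> ~~ win false (v |: M) B) -> ~~ win true M B.
Proof.
move=> uF H; rewrite (win_maker uF); apply/existsPn => v; rewrite negb_and.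
by case vF: (v \notin _); rewrite //= H.
Qed.

Lemma breaker_threat u M B D : [disjoint M & B] -> u \notin M :|: B ->
  D \subset u |: B -> spoils D -> ~~ win false M B.
Proof.
move=> MB uF DB sD; apply: (breaker_moves uF); apply: breaker_done DB sD.
by rewrite disjointsU1r MB andbT; move: uF; rewrite inE => /norP[].
Qed.

(** After Breaker takes [u], only [v] can be missing from her winning set [D]. Any reply other than
    [v] loses to [breaker_threat], so she gains [u] without losing the move. *)
Lemma breaker_forces u v M B D : [disjoint M & B] ->
  u \notin M :|: B -> v \notin M :|: B -> u != v ->
  D \subset [set u; v] :|: B -> spoils D ->
  ~~ win false (v |: M) (u |: B) -> ~~ win false M B.
Proof.
move=> MB uF vF uv DB sD H; apply: (breaker_moves uF).
have vF' : v \notin M :|: (u |: B).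
  by move: vF; rewrite !inE !negb_or eq_sym uv.
apply: (maker_moves vF') => w wF; have [->//|wv] := eqVneq w v.
move: uF vF wF; rewrite !inE !negb_or => /andP[uM uB] /andP[vM vB] /and3P[wM wu wB].
apply: (breaker_threat (u := v) (D := D)) => //.
- by rewrite disjointsU1l disjointsU1r MB !inE negb_or wu wB uM.
- by rewrite !inE !negb_or vM vB eq_sym wv eq_sym uv.
- by rewrite setUCA setUA.
Qed.

(* A double threat: [a, a'] and [b, b'] are pairs of which Maker needs one
   each, so Breaker gains [a] and [b] with tempo, and then plays [c]. *)
Lemma breaker_double_forcing (a a' b b' c : T) M B D :
  [disjoint M & B] -> uniq [:: a; a'; b; b'; c] ->
  {in [:: a; a'; b; b'; c], forall v, v \notin M :|: B} ->
  spoils [set a; a'] -> spoils [set b; b'] ->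
  spoils D -> D \subset [set a; b; c] :|: B -> ~~ win false M B.
Proof.
move=> MB /= /and5P[]; rewrite !inE !negb_or => /and4P[aa' ab ab' ac].
move=> /and3P[a'b a'b' a'c] /andP[bb' bc] b'c _ F sa sb sD DB.
have := F a; have := F a'; have := F b; have := F b'; have := F c.
rewrite !inE !eqxx !orbT !negb_or /=.
move=> /(_ isT)/andP[cM cB] /(_ isT)/andP[b'M b'B] /(_ isT)/andP[bM bB].
move=> /(_ isT)/andP[a'M a'B] /(_ isT)/andP[aM aB].
have d1 : [disjoint a' |: M & a |: B].
  by rewrite disjointsU1l disjointsU1r MB !inE negb_or eq_sym aa' a'B aM.
have d2 : [disjoint b' |: (a' |: M) & b |: (a |: B)].
  rewrite disjointsU1l disjointsU1r d1 !inE !negb_or eq_sym bb' b'B bM.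
  by rewrite eq_sym ab' eq_sym a'b.
apply: (breaker_forces (u := a) (v := a') _ _ _ _ _ sa) => //;
  rewrite ?inE ?negb_or ?aM ?aB ?a'M ?a'B ?subsetUl //.
apply: (breaker_forces (u := b) (v := b') _ _ _ _ _ sb) => //;
  rewrite ?inE ?negb_or ?bM ?bB ?b'M ?b'B ?subsetUl //.
- by rewrite eq_sym a'b eq_sym ab.
- by rewrite eq_sym a'b' eq_sym ab'.
apply: (breaker_threat (u := c) _ _ _ sD) => //.
  rewrite !inE !negb_or cM cB !andbT.
  by rewrite eq_sym b'c eq_sym a'c eq_sym bc eq_sym ac.
apply: subset_trans DB _; apply/subsetP => x; rewrite !inE.
by case/orP=> [/orP[/orP[]|]|] ->; rewrite ?orbT.
Qed.

(** Maker answers a move at [v] by [p v]; fixed points of [p] are the unpaired vertices, and [M0] is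
    what he owns beforehand. *)
Lemma pairing_strategy (p : T -> T) M0 : involutive p ->
  (forall S, M0 \subset S ->
     (forall v, p v != v -> (v \in S) || (p v \in S)) -> resolving e k S) ->
  forall M B, M0 \subset M ->
  (forall v, p v != v -> v \in B -> p v \in M) -> win false M B.
Proof.
move=> pK Hres.
(* On Maker's turn the invariant may fail at one vertex [w], Breaker's last move, whose partner is
   not yet taken. *)
suff main b M B : forall w, M0 \subset M ->
    (forall v, p v != v -> v \in B ->
       (p v \in M) || [&& b, v == w & p v \notin B]) -> win b M B.
  move=> M B sM inv; have [T0|[w _]] := set_0Vmem [set: T].
    rewrite win_over; last by apply/setP => v; have := in_setT v; rewrite T0 inE.
    by apply: Hres => // v; have := in_setT v; rewrite T0 inE.
  by apply: (main false M B w) => // v pv vB; rewrite inv.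
move: b M B; apply: win_ind => [b M B full|M B v vF IH|M B v vF IH] w sM inv.
- rewrite win_over //; apply: Hres => // v pv.
  have fullP u : (u \in M) || (u \in B) by rewrite -in_setU full inE.
  have := fullP v; case vM: (v \in M) => //= vB.
  have /orP[//|/and3P[_ _ pvB]] := inv v pv vB.
  by have := fullP (p v); rewrite (negPf pvB) orbF.
- rewrite (win_maker vF); apply/existsP.
  (* Maker takes the partner of [w] if it is free. Otherwise no pair is in danger and any free
     vertex preserves the invariant. *)
  have [/and3P[pw wB pwF]|Nw] := boolP [&& p w != w, w \in B & p w \notin M :|: B].
    exists (p w); rewrite pwF; apply: (IH _ _ w) => //.
      by rewrite subsetU // sM orbT.
    move=> u pu uB; rewrite !inE orbF.
    by have /orP[->|/and3P[_ /eqP-> _]] := inv u pu uB; rewrite ?eqxx ?orbT.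
  exists v; rewrite vF; apply: (IH _ _ w) => //.
    by rewrite subsetU // sM orbT.
  move=> u pu uB; rewrite !inE orbF.
  have /orP[->|/and3P[_ /eqP uw puB]] := inv u pu uB; first by rewrite orbT.
  move: Nw; rewrite -uw pu uB !inE (negPf puB) orbF negbK => ->.
  by rewrite orbT.
- rewrite (win_breaker vF); apply/forallP => u; apply/implyP => uF.
  apply: (IH _ uF u) => // x px; rewrite !inE.
  have [xu _|_ /= xB] := eqVneq x u; last by have := inv x px xB; rewrite orbF => ->.
  subst x; rewrite /= (negPf px) /=.
  have [puB|] := boolP (p u \in B); last by rewrite orbT.
  have := inv (p u); rewrite pK eq_sym => /(_ px puB).
  by move: uF; rewrite inE negb_or => /andP[/negPf-> _].
Qed.

End Game.

(** * Truncated distances through balls *)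

Section Distance.
Variables (T : finType) (e : rel T).
Implicit Types (x y z : T) (S : {set T}).

Lemma ball_leq n m x y : n <= m -> y \in ball e n x -> y \in ball e m x.
Proof.
move=> /subnK<-; elim: (m - n) => //= d IHd yn.
by rewrite inE IHd.
Qed.

(** The definition of [ball] adds the last step of a path; here the first step is split off, which
    suits centres with a known neighbourhood. *)
Lemma ballS n x y :
  (y \in ball e n.+1 x) = (y == x) || [exists w, e x w && (y \in ball e n w)].
Proof.
elim: n y => [|n IHn] y; first rewrite /= !inE; [congr (_ || _)|].
  apply/exists_inP/existsP => [[z]|[z /andP[xz]]]; rewrite in_set1.
    by move=> /eqP-> xy; exists y; rewrite xy in_set1 eqxx.
  by move=> /eqP->; exists x; rewrite // in_set1.
rewrite -/(ball e n.+1) [LHS]inE -/(ball e n.+1) in_set IHn.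
apply/idP/idP => [/orP[/orP[->//|/existsP[w /andP[xw yw]]]|]|].
- by apply/orP; right; apply/existsP; exists w; rewrite xw /= inE yw.
- move=> /exists_inP[z]; rewrite IHn => /orP[/eqP-> xy|/existsP[w /andP[xw zw]] zy].
    apply/orP; right; apply/existsP; exists y; rewrite xy.
    by apply: (ball_leq (leq0n _)); rewrite inE.
  apply/orP; right; apply/existsP; exists w; rewrite xw /= !inE.
  by apply/orP; right; apply/exists_inP; exists z.
- case/orP=> [->//|/existsP[w /andP[xw]]]; rewrite /= inE => /orP[yw|].
    by apply/orP; left; apply/orP; right; apply/existsP; exists w; rewrite xw.
  rewrite inE => /exists_inP[z zw zy]; apply/orP; right; apply/exists_inP.
  exists z => //; rewrite IHn; apply/orP; right; apply/existsP.
  by exists w; rewrite xw.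
Qed.

Lemma ball_sym n x y : symmetric e -> (y \in ball e n x) = (x \in ball e n y).
Proof.
move=> eC; suff sub u v : v \in ball e n u -> u \in ball e n v.
  by apply/idP/idP; apply: sub.
elim: n u v => [|n IHn] u v; first by rewrite !inE eq_sym.
rewrite ballS => /orP[/eqP->|/existsP[w /andP[uw /IHn wv]]].
  by apply: (ball_leq (leq0n _)); rewrite inE.
rewrite !inE; apply/orP; right; apply/exists_inP; exists w => //.
by rewrite eC.
Qed.

Lemma ball1 x y : (y \in ball e 1 x) = (y == x) || e x y.
Proof.
rewrite ballS; congr (_ || _); apply/existsP/idP => [[w]|xy].
  by rewrite inE => /andP[xw /eqP->].
by exists y; rewrite xy inE eqxx.
Qed.

Lemma ball_connect n x y : y \in ball e n x -> connect e x y.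
Proof.
elim: n x => [|n IHn] x; first by rewrite inE => /eqP->.
rewrite ballS => /orP[/eqP->//|/existsP[w /andP[xw /IHn]]].
exact/connect_trans/connect1.
Qed.

(** Balls increase with the radius, so the first hit of the search decides; the bound on [n] keeps
    it inside the searched range. *)
Lemma dist_leq n x y : n < #|T| -> (dist e x y <= n) = (y \in ball e n x).
Proof.
move=> nT; apply/idP/idP => [le_dn|yn].
  apply: (ball_leq le_dn).
  have lt_dT : dist e x y < #|T| by apply: leq_ltn_trans nT.
  have : has (fun m => y \in ball e m x) (iota 0 #|T|) by rewrite has_find size_iota.
  by move=> /(nth_find 0); rewrite nth_iota.
rewrite leqNgt; apply/negP => lt_nd.
by have := before_find 0 lt_nd; rewrite nth_iota // yn.
Qed.

Lemma eq_dist x y z : (forall n, (z \in ball e n x) = (z \in ball e n y)) ->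
  dist e x z = dist e y z.
Proof. by move=> H; apply: eq_find => n; rewrite /= H. Qed.

Lemma eq_distk k x y z : k < #|T| ->
  (forall n, n <= k -> (z \in ball e n x) = (z \in ball e n y)) ->
  distk e k x z = distk e k y z.
Proof.
move=> kT H; rewrite /distk.
have {}H n : n <= k -> (dist e x z <= n) = (dist e y z <= n).
  by move=> nk; rewrite !dist_leq ?H // (leq_ltn_trans nk).
have := H k (leqnn k); have := H (dist e x z); have := H (dist e y z).
rewrite !leqnn; lia.
Qed.

Lemma distk_ball k n x y z : k < #|T| -> n <= k ->
  distk e k x z = distk e k y z -> (z \in ball e n x) = (z \in ball e n y).
Proof.
move=> kT nk; rewrite /distk -!dist_leq ?(leq_ltn_trans nk) //; lia.
Qed.

(** For [k <= m], $d_k$ is a further truncation of $d_m$, so whatever $d_k$ separates, $d_m$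
    separates. *)
Lemma resolving_leq k m S : k <= m -> resolving e k S -> resolving e m S.
Proof.
move=> km /resolvingP H; apply/resolvingP => x y /H[z zS xyz]; exists z => //.
by apply: contra_neq xyz; rewrite /distk; lia.
Qed.

(** When the diameter is at most [k.+1], truncating at [k.+1] or later leaves every distance
    unchanged. *)
Lemma resolving_diam k m S : k.+1 < #|T| ->
  (forall x y, y \in ball e k.+1 x) -> k <= m ->
  resolving e m S = resolving e k S.
Proof.
move=> kT diam km; apply/idP/idP; last exact: resolving_leq.
move=> /resolvingP H; apply/resolvingP => x y /H[z zS xyz]; exists z => //.
have := diam x z; have := diam y z; rewrite -!dist_leq //.
move: xyz; rewrite /distk; lia.
Qed.

Lemma eq_maker_wins k m n b M B :
  (forall S, resolving e k S = resolving e m S) ->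
  maker_wins e k n b M B = maker_wins e m n b M B.
Proof.
move=> E; elim: n b M B => [|n IHn] b M B /=; first exact: E.
case: ifP => // _; case: b.
  by apply: eq_existsb => v; rewrite IHn.
by apply: eq_forallb => v; rewrite IHn.
Qed.

Lemma eq_O_R k m : (forall S, resolving e k S = resolving e m S) ->
  O_R e k = O_R e m.
Proof.
by move=> E; rewrite /O_R /maker_first_wins /maker_second_wins !(eq_maker_wins _ _ _ _ E).
Qed.

End Distance.

(** * The game as a hitting game on a hypergraph *)

Section HypergraphGame.
Variables (T : finType) (e : rel T) (k : nat).
Implicit Types (M B S : {set T}) (F h : seq T) (H : seq (seq T)).

Lemma win_decided b M B c : [disjoint M & B] ->
  (forall S, M \subset S -> [disjoint S & B] -> resolving e k S = c) ->
  win e k b M B = c.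
Proof.
move: b M B; apply: win_ind => [b M B full|M B v vF IH|M B v vF IH] MB Hc.
- by rewrite win_over ?Hc.
- have IH' w : w \notin M :|: B -> win e k false (w |: M) B = c.
    move=> wF; apply: IH => // [|S]; last by rewrite subUset => /andP[_]; apply: Hc.
    by rewrite disjointsU1l MB andbT; move: wF; rewrite inE => /norP[].
  rewrite (win_maker _ _ vF); apply/existsP/idP => [[w /andP[/IH' ->]]//|c1].
  by exists v; rewrite vF IH'.
- have IH' w : w \notin M :|: B -> win e k true M (w |: B) = c.
    move=> wF; apply: IH => // [|S MS]; last first.
      by move=> SB; apply: Hc => //; apply: disjointWr SB; apply: subsetUr.
    by rewrite disjointsU1r MB andbT; move: wF; rewrite inE => /norP[].
  rewrite (win_breaker _ _ vF); apply/forallP/idP => [/(_ v)|c1 w].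
    by rewrite vF IH'.
  by apply/implyP => /IH' ->.
Qed.

(* [F] lists the free vertices, and [H] the sets that Maker still has to hit,
   reduced to free vertices. *)
Fixpoint game (n : nat) (b : bool) F H : bool :=
  if H is [::] then true else
  if [::] \in H then false else
  if n is n'.+1 then
    if b then
      has (fun v => game n' false (filter (predC1 v) F)
                         [seq h <- H | v \notin h]) F
    else
      all (fun v => game n' true (filter (predC1 v) F)
                         [seq filter (predC1 v) h | h <- H]) F
  else false.

Lemma game_nil n b F : game n b F [::] = true.
Proof. by case: n. Qed.

Lemma game_lost n b F H : [::] \in H -> game n b F H = false.
Proof. by case: n => [|n] H0 /=; rewrite H0; case: H H0. Qed.

Lemma game_step n b F H : H != [::] -> [::] \notin H ->
  game n.+1 b F H =
    if b then
      has (fun v => game n false (filter (predC1 v) F)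
                         [seq h <- H | v \notin h]) F
    else
      all (fun v => game n true (filter (predC1 v) F)
                         [seq filter (predC1 v) h | h <- H]) F.
Proof. by move=> H0 H1; rewrite /= (negPf H1); case: H H0 {H1}. Qed.

Lemma win_game_over b M B F H : [disjoint M & B] ->
  (forall S, M \subset S -> [disjoint S & B] ->
     resolving e k S = all (has (mem S)) H) ->
  (H == [::]) || ([::] \in H) ->
  win e k b M B = game #|~: (M :|: B)| b F H.
Proof.
move=> MB HE /orP[/eqP H0|H1].
  by rewrite H0 game_nil; apply: win_decided => // S MS SB; rewrite HE // H0.
rewrite game_lost //; apply: win_decided => // S MS SB; rewrite HE //.
by apply/allPn; exists [::].
Qed.

(** Among the final sets still possible, the resolving ones are the transversals of [H]. Maker's
    move deletes the edges through his vertex, Breaker's move deletes her vertex from every edge,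
    and both preserve this correspondence. *)
Lemma winE b M B F H : [disjoint M & B] ->
  (forall v, (v \in F) = (v \notin M :|: B)) ->
  (forall h, h \in H -> {subset h <= F}) ->
  (forall S, M \subset S -> [disjoint S & B] ->
     resolving e k S = all (has (mem S)) H) ->
  win e k b M B = game #|~: (M :|: B)| b F H.
Proof.
move: b M B F H.
apply: (win_ind (P := fun b M B => forall F H, _ -> _ -> _ -> _ -> win e k b M B = _))
  => [b M B full|M B v vF IH|M B v vF IH] F H MB FE HF HE;
  have [|/norP[H0 H1]] := boolP ((H == [::]) || ([::] \in H));
  try exact: win_game_over.
(* With no free vertex left, any remaining edge would be empty, which [H1] excludes. *)
- case: H H0 H1 HF {HE} => [|[|u h] H] // _ _ /(_ _ (mem_head _ _) u (mem_head _ _)).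
  by rewrite FE full inE.
- rewrite (win_maker _ _ vF) (card_free vF) game_step //.
  have IHE w : w \notin M :|: B -> win e k false (w |: M) B =
      game #|~: (v |: M :|: B)| false (filter (predC1 w) F) [seq h <- H | w \notin h].
    move=> wF; have [->] : #|~: (v |: M :|: B)|.+1 = #|~: (w |: M :|: B)|.+1.
      by rewrite -!card_free.
    apply: IH => // [|u|h|S].
    - by rewrite disjointsU1l MB andbT; move: wF; rewrite inE => /norP[].
    - by rewrite mem_filter FE !inE !negb_or andbA.
    - rewrite mem_filter => /andP[wh hH] u uh; rewrite mem_filter (HF h) //= andbT.
      by apply: contraNneq wh => <-.
    rewrite subUset sub1set => /andP[wS MS] SB; rewrite HE // all_filter.
    apply: eq_all => h /=; case wh: (w \in h) => //=.
    by apply/hasP; exists w.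
  apply/existsP/hasP => [[w /andP[wF]]|[w]].
    by rewrite IHE // => ?; exists w; rewrite // FE.
  by rewrite FE => wF ?; exists w; rewrite wF IHE.
- rewrite (win_breaker _ _ vF) (card_free vF) game_step //.
  have IHE w : w \notin M :|: B -> win e k true M (w |: B) =
      game #|~: (v |: M :|: B)| true (filter (predC1 w) F) [seq filter (predC1 w) h | h <- H].
    move=> wF; have [->] : #|~: (v |: M :|: B)|.+1 = #|~: (M :|: (w |: B))|.+1.
      by rewrite setUCA setUA -!card_free.
    apply: IH => // [|u|_ /mapP[h hH ->] u|S].
    - by rewrite disjointsU1r MB andbT; move: wF; rewrite inE => /norP[].
    - by rewrite mem_filter FE !inE !negb_or andbCA.
    - by rewrite !mem_filter => /andP[-> /(HF h hH)->].
    rewrite disjointsU1r => MS /andP[wS SB]; rewrite HE // all_map.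
    apply: eq_all => h /=; rewrite [RHS]has_filter -filter_predI -has_filter.
    apply: eq_has => u /=; have [->|] := eqVneq u w; last by rewrite andbT.
    by rewrite (negPf wS).
  apply/forallP/allP => [Hw w|Hw w].
    by rewrite FE => wF; have := Hw w; rewrite wF IHE.
  by apply/implyP => wF; rewrite IHE // Hw // FE.
Qed.

End HypergraphGame.

(** * Evaluation of the game from an explicit vertex list *)

Section FiniteCheck.
Variables (T : finType) (e : rel T) (vs : seq T).
Hypothesis mem_vs : forall v, v \in vs.

Fixpoint reach (n : nat) (x y : T) : bool :=
  (y == x) ||
  (if n is n'.+1 then has (fun w => e x w && reach n' w y) vs else false).

Lemma reachE n x y : reach n x y = (y \in ball e n x).
Proof.
elim: n x => [|n IHn] x; first by rewrite /= inE orbF.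
rewrite ballS /=; congr (_ || _); apply/hasP/existsP => [[w _]|[w]] H; exists w => //.
  by rewrite -IHn.
by rewrite IHn.
Qed.

(** Since $d_k$ is truncated at [k.+1], it separates two vertices exactly when some ball of radius
    at most [k] does. *)
Definition distinguishers (k : nat) : seq (seq T) :=
  [seq [seq z <- vs | has (fun n => reach n p.1 z != reach n p.2 z) (iota 0 k.+1)]
     | p <- [seq (x, y) | x <- vs, y <- vs] & p.1 != p.2].

(** Both orders of a pair produce the same edge; [undup] removes such repetitions before the game
    tree is searched. *)
Definition outcome_game (k n : nat) : outcome :=
  let H := undup (distinguishers k) in
  match game n true vs H, game n false vs H with
  | true, true => OM
  | true, false => ON
  | false, false => OB
  | false, true => OSecond
  end.

Lemma O_R_game k : k < #|T| -> O_R e k = outcome_game k #|T|.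
Proof.
move=> kT; rewrite /O_R maker_first_winsE maker_second_winsE.
have E b : win e k b set0 set0 = game #|T| b vs (undup (distinguishers k)).
  rewrite (@winE _ _ _ b _ _ vs (undup (distinguishers k))).
  - by rewrite setU0 setC0 cardsT.
  - by rewrite -setI_eq0 setI0.
  - by move=> v; rewrite mem_vs !inE.
  - by move=> h _ u _.
  move=> S _ _; rewrite (eq_all_r (mem_undup _)) all_map all_filter.
  have allP2 (x y : T) : (x, y) \in [seq (x, y) | x <- vs, y <- vs].
    by apply/allpairsP; exists (x, y); rewrite !mem_vs.
  have zP x y z : reflect (distk e k x z = distk e k y z)
      (~~ has (fun n => reach n x z != reach n y z) (iota 0 k.+1)).
    apply: (iffP hasPn) => [Hn|xyz n].
      apply: eq_distk => // n nk; rewrite -!reachE; apply/eqP.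
      by have := Hn n; rewrite mem_iota add0n ltnS nk negbK => /(_ isT).
    by rewrite mem_iota ltnS negbK !reachE => nk; apply/eqP/(distk_ball kT).
  apply/resolvingP/allP => [HS [x y] _ /=|HS x y xy].
    apply/implyP => /HS[z zS xyz]; apply/hasP; exists z => //.
    by rewrite mem_filter mem_vs andbT; apply: contraNT xyz => /zP->.
  have /= := HS (x, y) (allP2 x y); rewrite xy => /hasP[z].
  rewrite mem_filter => /andP[zh _] zS; exists z => //.
  by apply: contraTneq zh => /zP.
by rewrite /outcome_game !E.
Qed.

Lemma all_reach n : all (fun x => all (reach n x) vs) vs ->
  forall x y, y \in ball e n x.
Proof. by move=> /allP H x y; rewrite -reachE; apply: (allP (H x _)). Qed.

Lemma O_R_game_diam k m : k.+1 < #|T| -> all (fun x => all (reach k.+1 x) vs) vs ->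
  k <= m -> O_R e m = outcome_game k #|T|.
Proof.
move=> kT Hr km; rewrite -O_R_game ?(ltnW kT) //; apply: eq_O_R => S.
by apply: resolving_diam => //; apply: all_reach.
Qed.

End FiniteCheck.

(* [ord_enum] is built with the opaque [idP] and does not compute. *)
Fixpoint ords (n : nat) : seq 'I_n :=
  if n is m.+1 then ord0 :: map (lift ord0) (ords m) else [::].

Lemma mem_ords n (i : 'I_n) : i \in ords n.
Proof.
elim: n i => [[]//|n IHn] i /=; rewrite inE.
by case: (unliftP ord0 i) => [j|] ->; rewrite ?eqxx // map_f ?orbT.
Qed.

(** * Small graphs given by edge lists, for parts (a) to (f) *)

Section SmallGraphs.
Variables (n : nat) (E : seq (nat * nat)).

Definition edge_rel : rel 'I_n :=
  fun i j => ((i : nat, j : nat) \in E) || ((j : nat, i : nat) \in E).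

Lemma edge_rel_graph d : all (fun p => p.1 != p.2) E ->
  all (fun x => all (reach edge_rel (ords n) d x) (ords n)) (ords n) ->
  simple_connected_graph edge_rel.
Proof.
move=> /allP ne Hr; split=> [i j|i|x y]; first by rewrite /edge_rel orbC.
  by rewrite /edge_rel orbb; apply/negP => /ne /=; rewrite eqxx.
exact/ball_connect/(all_reach (@mem_ords n) Hr).
Qed.

Lemma O_R_edge_rel k : k < n ->
  O_R edge_rel k = outcome_game edge_rel (ords n) k n.
Proof.
move=> kn; rewrite (O_R_game _ (@mem_ords n)) ?card_ord //.
Qed.

Lemma O_R_edge_rel_diam k o m : k.+1 < n ->
  all (fun x => all (reach edge_rel (ords n) k.+1 x) (ords n)) (ords n) ->
  outcome_game edge_rel (ords n) k n = o -> k <= m -> O_R edge_rel m = o.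
Proof.
by move=> kn Hr <- km; rewrite (O_R_game_diam (@mem_ords n) _ Hr km) card_ord.
Qed.

End SmallGraphs.


(** Either end of [path3] resolves it, so Maker pairs the ends. In a complete graph only the two
    vertices themselves separate a pair, so Maker needs all but one vertex: two of three in
    [triangle], three of four in [complete4]. *)
Definition path3 := @edge_rel 3 [:: (0, 1); (1, 2)].
Definition triangle := @edge_rel 3 [:: (0, 1); (0, 2); (1, 2)].
Definition complete4 :=
  @edge_rel 4 [:: (0, 1); (0, 2); (0, 3); (1, 2); (1, 3); (2, 3)].
Definition bull := @edge_rel 5 [:: (0, 1); (0, 2); (1, 2); (0, 4); (1, 3)].

(* The edge [1 - 2] with a common neighbour [6], three leaves at [1] and two
   leaves at [2]. *)
Definition triangle_3_2_leaves :=
  @edge_rel 8 [:: (1, 2); (1, 6); (2, 6); (1, 0); (1, 3); (1, 4); (2, 5); (2, 7)].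

(* The edge [0 - 1] with two common neighbours [3] and [6], two leaves at [0]
   and two leaves at [1]. *)
Definition diamond_2_2_leaves :=
  @edge_rel 8 [:: (0, 1); (0, 3); (1, 3); (0, 6); (1, 6); (0, 4); (0, 5); (1, 2); (1, 7)].

(** * The graph of part (g): vertices, adjacency and balls *)

Section GadgetGraph.
Variable alpha : nat.
Local Notation T := (gV alpha).
Local Notation e := (@g_adj alpha).
Implicit Types (i j : 'I_alpha) (b : bool) (u w : T) (M B S : {set T}).

Definition spine i : T := inl (i, @Ordinal 6 0 isT).
Definition leaf i b : T := inl (i, if b then @Ordinal 6 2 isT else @Ordinal 6 1 isT).
Definition side i b : T := inl (i, if b then @Ordinal 6 4 isT else @Ordinal 6 3 isT).
Definition apex i : T := inl (i, @Ordinal 6 5 isT).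
Definition hub : T := inr true.
Definition pendant : T := inr false.

Lemma gV_ind (P : T -> Prop) :
  (forall i, P (spine i)) -> (forall i b, P (leaf i b)) ->
  (forall i b, P (side i b)) -> (forall i, P (apex i)) -> P hub -> P pendant ->
  forall u, P u.
Proof.
move=> Pv Pl Ps Px Py Pz [[i t]|[]] //.
by case: t => [[|[|[|[|[|[|//]]]]]] lt_t6];
  [have := Pv i | have := Pl i false | have := Pl i true
  | have := Ps i false | have := Ps i true | have := Px i];
  congr (P (inl (_, _))); apply: val_inj.
Qed.

Lemma g_sym : symmetric e.
Proof. by move=> u w; rewrite /g_adj orbC. Qed.

Lemma spine_eq i j : (spine i == spine j) = (i == j).
Proof. by apply/eqP/eqP => [[]|->]. Qed.
Lemma leaf_eq i j b b' : (leaf i b == leaf j b') = (i == j) && (b == b').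
Proof.
by apply/eqP/andP => [[-> bb']|[/eqP-> /eqP-> //]]; split=> //; case: b b' bb' => [] [].
Qed.
Lemma side_eq i j b b' : (side i b == side j b') = (i == j) && (b == b').
Proof.
by apply/eqP/andP => [[-> bb']|[/eqP-> /eqP-> //]]; split=> //; case: b b' bb' => [] [].
Qed.
Lemma apex_eq i j : (apex i == apex j) = (i == j).
Proof. by apply/eqP/eqP => [[]|->]. Qed.

Lemma gV_neqE :
  ((forall i j b', (spine i == leaf j b') = false) *
   (forall i j b', (spine i == side j b') = false) *
   (forall i j, (spine i == apex j) = false) *
   (forall i, (spine i == hub) = false) *
   (forall i, (spine i == pendant) = false) *
   (forall i b j, (leaf i b == spine j) = false) *
   (forall i b j b', (leaf i b == side j b') = false) *
   (forall i b j, (leaf i b == apex j) = false) *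
   (forall i b, (leaf i b == hub) = false) *
   (forall i b, (leaf i b == pendant) = false) *
   (forall i b j, (side i b == spine j) = false) *
   (forall i b j b', (side i b == leaf j b') = false) *
   (forall i b j, (side i b == apex j) = false) *
   (forall i b, (side i b == hub) = false) *
   (forall i b, (side i b == pendant) = false) *
   (forall i j, (apex i == spine j) = false) *
   (forall i j b', (apex i == leaf j b') = false) *
   (forall i j b', (apex i == side j b') = false) *
   (forall i, (apex i == hub) = false) *
   (forall i, (apex i == pendant) = false) *
   (forall j, (hub == spine j) = false) *
   (forall j b', (hub == leaf j b') = false) *
   (forall j b', (hub == side j b') = false) *
   (forall j, (hub == apex j) = false) *
   ((hub == pendant) = false) *
   (forall j, (pendant == spine j) = false) *
   (forall j b', (pendant == leaf j b') = false) *
   (forall j b', (pendant == side j b') = false) *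
   (forall j, (pendant == apex j) = false) *
   ((pendant == hub) = false))%type.
Proof.
do !split; intros; apply/eqP;
  by repeat match goal with x : bool |- _ => destruct x end.
Qed.

Definition gV_eqE := (spine_eq, leaf_eq, side_eq, apex_eq, gV_neqE, eqxx).

Ltac gV_cases w := elim/gV_ind: w; intros;
  repeat match goal with x : bool |- _ => destruct x end;
  rewrite ?gV_eqE /g_adj /= ?(orbF, orbT, andbF, andbT) //.

Lemma g_leaf i b w : e (leaf i b) w = (w == spine i).
Proof. by gV_cases w. Qed.

Lemma g_side i b w : e (side i b) w = (w == spine i) || (w == apex i).
Proof. by gV_cases w; rewrite eq_sym. Qed.

Lemma g_apex i w : e (apex i) w = [|| w == side i false, w == side i true | w == hub].
Proof. by gV_cases w. Qed.

Lemma g_hub w : e hub w = (w == pendant) || [exists i, w == apex i].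
Proof. 
gV_cases w; symmetry; try by apply/existsP => -[j]; rewrite gV_eqE.
by apply/existsP; exists i. 
Qed.

Lemma g_pendant w : e pendant w = (w == hub).
Proof. by gV_cases w. Qed.

Lemma g_spine_leaf i j b : e (spine i) (leaf j b) = (i == j).
Proof. by rewrite g_sym g_leaf gV_eqE. Qed.

Lemma g_spine_side i j b : e (spine i) (side j b) = (i == j).
Proof. by rewrite g_sym g_side !gV_eqE orbF. Qed.

Lemma ballS_leaf n i b w : (w \in ball e n.+1 (leaf i b)) =
  (w == leaf i b) || (w \in ball e n (spine i)).
Proof.
rewrite ballS; congr (_ || _); apply/existsP/idP => [[u]|wi].
  by rewrite g_leaf => /andP[/eqP->].
by exists (spine i); rewrite g_leaf eqxx.
Qed.

Lemma ballS_side n i b w : (w \in ball e n.+1 (side i b)) =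
  [|| w == side i b, w \in ball e n (spine i) | w \in ball e n (apex i)].
Proof.
rewrite ballS; congr (_ || _); apply/existsP/orP => [[u]|].
  by rewrite g_side => /andP[/orP[]/eqP->]; [left | right].
case=> wi; [exists (spine i) | exists (apex i)];
  by rewrite g_side eqxx ?orbT.
Qed.

Lemma ballS_pendant n w : (w \in ball e n.+1 pendant) =
  (w == pendant) || (w \in ball e n hub).
Proof.
rewrite ballS; congr (_ || _); apply/existsP/idP => [[u]|wi].
  by rewrite g_pendant => /andP[/eqP->].
by exists hub; rewrite g_pendant eqxx.
Qed.

Lemma ballS_hub n w : (w \in ball e n.+1 hub) =
  [|| w == hub, w \in ball e n pendant | [exists i, w \in ball e n (apex i)]].
Proof.
rewrite ballS; congr (_ || _); apply/existsP/orP => [[u]|].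
  rewrite g_hub => /andP[/orP[/eqP->|/existsP[i /eqP->]] wu]; first by left.
  by right; apply/existsP; exists i.
case=> [wz|/existsP[i wi]]; first by exists pendant; rewrite g_hub eqxx.
by exists (apex i); rewrite g_hub wi andbT; apply/orP; right; apply/existsP; exists i.
Qed.

(** This places all levels [k <= 3] within the range where distances are governed by balls. *)
Lemma card_gV_gt3 : 0 < alpha -> 3 < #|T|.
Proof. by rewrite card_sum card_prod !card_ord card_bool; lia. Qed.

Lemma g_connected : simple_connected_graph e.
Proof.
split=> [||u w]; first exact: g_sym.
  by move=> u; gV_cases u; rewrite ?orbb; apply/negP; lia.
have cS : connect_sym e := sym_connect_sym g_sym.
suff toHub x : connect e x hub by apply: connect_trans (toHub u) _; rewrite cS.
have xH i : connect e (apex i) hub by apply: connect1; rewrite g_apex eqxx !orbT.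
have sH i b : connect e (side i b) hub.
  by apply: connect_trans (xH i); apply: connect1; rewrite g_side eqxx orbT.
have vH i : connect e (spine i) hub.
  by apply: connect_trans (sH i true); apply: connect1; rewrite g_spine_side.
elim/gV_ind: x => // [i b|]; last by apply: connect1; rewrite g_pendant.
by apply: connect_trans (vH i); apply: connect1; rewrite g_leaf.
Qed.

(** * Breaker's strategy on the gadgets *)

Section Breaker.
Variable k : nat.

(** A path from either twin to a third vertex starts at a common neighbour, so only the twins
    themselves separate them. *)
Lemma spoils_twins u w : u != w -> e u =1 e w -> spoils e k [set u; w].
Proof.
move=> uw uwE S dS; apply: (unresolved uw) => z zS.
have [zu zw] : (z == u) = false /\ (z == w) = false.
  by have := disjointFr dS zS; rewrite !inE => /norP[/negPf-> /negPf->].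
congr minn; apply: eq_dist => -[|n]; first by rewrite !inE zu zw.
by rewrite !ballS zu zw; apply: eq_existsb => v; rewrite uwE.
Qed.

(** Apart from the two centres, the unit balls differ only in the apex. At radius 2 the side vertex
    also reaches, through the apex, the hub, which lies in [B], and its twin, which the leaf reaches
    through the spine. *)
Lemma spoils_leaf_side i (B : {set T}) :
  (k == 1) || (k == 2) && (hub \in B) ->
  spoils e k ([set leaf i true; side i true; apex i] :|: B).
Proof.
move=> kB S dS; apply: (@unresolved _ _ _ _ (leaf i true) (side i true)).
  by rewrite gV_eqE.
move=> z zS; have := disjointFr dS zS; rewrite !inE.
move=> /norP[/norP[/norP[/negPf zl /negPf zs] /negPf zx] /negPf zB].
apply: eq_distk => [|n].
  by apply: leq_trans (card_gV_gt3 (leq_ltn_trans (leq0n i) (ltn_ord i))); lia.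
case: n => [|[|[|n]]]; last by lia.
- by rewrite !inE zl zs.
- by rewrite !ballS_leaf ballS_side !inE zl zs zx orbF.
move=> k2; have {kB k2} zy : (z == hub) = false.
  by apply: contraTF kB => /eqP zy; rewrite -zy zB; lia.
rewrite !ballS_leaf ballS_side !ball1 g_apex zl zs zx zy /= orbF.
by case: (eqVneq z (side i false)) => [->|]; rewrite ?orbF // g_spine_side eqxx !orbT.
Qed.

Lemma untouched_gadget_lost i M B : [disjoint M & B] ->
  (k == 1) || (k == 2) && (hub \in B) ->
  (forall t, inl (i, t) \notin M :|: B) -> ~~ win e k false M B.
Proof.
move=> MB kB Fi.
apply: (breaker_double_forcing (a := leaf i true) (a' := leaf i false)
  (b := side i true) (b' := side i false) (c := apex i) MB _ _ _ _
  (spoils_leaf_side kB)) => //.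
- by rewrite /= !inE !gV_eqE.
- by move=> v; rewrite !in_cons in_nil orbF => /or4P[| | |/orP[]] /eqP->; apply: Fi.
- by apply: spoils_twins => [|w]; rewrite ?gV_eqE // !g_leaf.
- by apply: spoils_twins => [|w]; rewrite ?gV_eqE // !g_side.
Qed.

(** The hub lies in no gadget and [v] in at most one, so one of the first two gadgets is
    untouched. *)
Lemma untouched_gadget_lost1 v M B : 1 < alpha -> [disjoint M & B] ->
  (k == 1) || (k == 2) && (hub \in B) ->
  M :|: B \subset [set v; hub] -> ~~ win e k false M B.
Proof.
move=> a1 MB kB sMB.
have [i vi] : exists i, forall t, inl (i, t) != v.
  case: v sMB => [[i t']|b] _; last by exists (Ordinal a1).
  (* Gadget 1 is chosen if [v] lies in gadget 0, and gadget 0 otherwise. *)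
  have [i0|i0] := eqVneq (val i) 0.
    by exists (Ordinal a1) => t; apply/eqP => -[/(congr1 val)]; rewrite /= i0.
  exists (Ordinal (ltnW a1)) => t; apply/eqP => -[/(congr1 val)] /= i0'.
  by case/eqP: i0; apply: esym.
apply: (untouched_gadget_lost (i := i)) => // t; apply/negP => /(subsetP sMB).
by rewrite !inE (negPf (vi t)).
Qed.

End Breaker.

Lemma breaker_wins_1 : 1 < alpha -> O_R e 1 = OB.
Proof.
move=> a1; rewrite /O_R maker_first_winsE maker_second_winsE.
have d0 (A : {set T}) : [disjoint A & set0] by rewrite -setI_eq0 setI0.
have -> : win e 1 false set0 set0 = false.
  by apply/negbTE; apply: (untouched_gadget_lost1 (v := hub) a1); rewrite ?setU0 ?sub0set.
have -> : win e 1 true set0 set0 = false; last by [].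
apply/negbTE; apply: (maker_moves (u := hub)) => [|v _]; first by rewrite !inE.
apply: (untouched_gadget_lost1 (v := v) a1) => //.
by rewrite !setU0 subsetUl.
Qed.

(** Breaker opens with the hub. Maker's reply touches at most one gadget, and she wins in
    another. *)
Lemma breaker_first_wins_2 : 1 < alpha -> ~~ win e 2 false set0 set0.
Proof.
move=> a1; apply: (breaker_moves (v := hub)); first by rewrite !inE.
apply: (maker_moves (u := pendant)) => [|v]; first by rewrite !inE.
rewrite !inE !orbF !setU0 => vh.
apply: (untouched_gadget_lost1 (v := v) a1) => //; last by rewrite inE.
by rewrite disjoints_subset sub1set !inE.
Qed.

(** * Resolving sets of the gadget graph and Maker's strategy *)

Lemma ball1_hubE :
  ((forall i, (spine i \in ball e 1 hub) = false) *
   (forall i b, (leaf i b \in ball e 1 hub) = false) *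
   (forall i b, (side i b \in ball e 1 hub) = false) *
   (forall i, apex i \in ball e 1 hub) *
   (hub \in ball e 1 hub) * (pendant \in ball e 1 hub))%type.
Proof.
do !split; intros; rewrite ball1 g_hub !gV_eqE //=;
  by [apply/existsP => -[j]; rewrite gV_eqE | apply/existsP; exists i].
Qed.

Lemma ball2_hubE :
  ((forall i, (spine i \in ball e 2 hub) = false) *
   (forall i b, (leaf i b \in ball e 2 hub) = false) *
   (forall i b, side i b \in ball e 2 hub))%type.
Proof.
do !split; intros; rewrite ballS_hub ball1 g_pendant !gV_eqE /=.
- by apply/existsP => -[j]; rewrite ball1 g_apex !gV_eqE.
- by apply/existsP => -[j]; rewrite ball1 g_apex !gV_eqE.
- by apply/existsP; exists i; rewrite ball1 g_apex !gV_eqE; case: b.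
Qed.

(** Radius 2 around a leaf tells which leaves and sides belong to its gadget. *)
Lemma ball2_leafE i j b b' :
  ((leaf j b' \in ball e 2 (leaf i b)) = (i == j)) *
  ((side j b' \in ball e 2 (leaf i b)) = (i == j)).
Proof.
rewrite !ballS_leaf !ball1 g_spine_leaf g_spine_side !gV_eqE /=; split=> //.
by case: (eqVneq i j) => _; rewrite ?orbT.
Qed.

(* The observers [c] and the balls around [hub] separate the vertices into
   [{hub}], [{pendant}], apexes, sides, and the rest; the chosen leaf and side
   of a gadget separate the remaining ones. *)
Lemma decode (f g : 'I_alpha -> bool) c u w : c \in [:: hub; pendant] ->
  (u == c) = (w == c) ->
  (forall n, 0 < n <= 2 -> (u \in ball e n hub) = (w \in ball e n hub)) ->
  (forall i n, n <= 2 -> (u \in ball e n (leaf i (f i))) = (w \in ball e n (leaf i (f i)))) ->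
  (forall i n, n <= 2 -> (u \in ball e n (side i (g i))) = (w \in ball e n (side i (g i)))) ->
  u = w.
Proof.
move=> cE uc uh ul us.
have h1 := uh 1 isT; have h2 := uh 2 isT.
have l0 i := ul i 0 isT; have l1 i := ul i 1 isT; have l2 i := ul i 2 isT.
have s0 i := us i 0 isT; have s1 i := us i 1 isT; have {uh ul us} s2 i := us i 2 isT.
elim/gV_ind: u uc h1 h2 l0 l1 l2 s0 s1 s2 => [i|i b|i b|i||];
  elim/gV_ind: w => [j|j b'|j b'|j||] uc h1 h2 l0 l1 l2 s0 s1 s2;
  move: h1 h2; rewrite ?ball1_hubE ?ball2_hubE // => _ _.
(* The balls around the hub have settled all pairs from different classes; twelve cases within a
   class remain. *)
- by have := l1 i; rewrite !ball1 g_leaf !gV_eqE /= g_leaf gV_eqE => /esym/eqP->.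
- have := l1 i; have := l0 i; rewrite !ball1 !g_leaf !inE !gV_eqE /=.
  by move=> <-.
- have := l1 j; have := l0 j; rewrite !ball1 !g_leaf !inE !gV_eqE /=.
  by move=> ->.
(* Radius 2 identifies the gadget. Of two distinct twins one is the observer itself, which radius 0
   detects; sides are treated alike. *)
- have := l2 i; rewrite !ball2_leafE eqxx => /esym/eqP ij; subst j.
  have := l0 i; rewrite !inE !gV_eqE /=.
  by case: b b' (f i) {l0 l1 l2 s0 s1 s2 uc} => [] [] [].
- have := l2 i; rewrite !ball2_leafE eqxx => /esym/eqP ij; subst j.
  have := s0 i; rewrite !inE !gV_eqE /=.
  by case: b b' (g i) {l0 l1 l2 s0 s1 s2 uc} => [] [] [].
- by have := s1 i; rewrite !ball1 !g_side !gV_eqE /= => /esym/eqP->.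
- by have := s1 i; rewrite !ball1 !g_side !gV_eqE.
- by have := s1 i; rewrite !ball1 !g_side !gV_eqE.
- by have := s1 j; rewrite !ball1 !g_side !gV_eqE.
(* Hub against pendant: [c] is one of the two, so [uc] separates them. *)
- by move: cE uc; rewrite !inE => /orP[] /eqP->; rewrite !gV_eqE.
- by have := s1 j; rewrite !ball1 !g_side !gV_eqE.
- by move: cE uc; rewrite !inE => /orP[] /eqP->; rewrite !gV_eqE.
Qed.

Lemma resolving_transversal (c : T) S k : 0 < alpha ->
  2 <= k -> (c = hub) \/ (c = pendant) /\ 2 < k -> c \in S ->
  (forall i, exists b, leaf i b \in S) -> (forall i, exists b, side i b \in S) ->
  resolving e k S.
Proof.
move=> a0 k2 ck cS leafS sideS.
(* Larger levels follow from level 3 by monotonicity, and levels up to 3 are below the number of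
   vertices. *)
wlog k3 : k k2 ck / k <= 3 => [IH|].
  have [?|k3] := leqP k 3; first exact: IH.
  apply: (resolving_leq (ltnW k3)); apply: IH => //.
  by case: ck => [|[? _]]; [left | right].
apply/resolvingP => u w uw; apply/exists_inP; apply: contraNT uw => /exists_inPn H.
have {}H z n : z \in S -> n <= k -> (u \in ball e n z) = (w \in ball e n z).
  move=> zS nk; rewrite -(ball_sym n u z g_sym) -(ball_sym n w z g_sym).
  apply: (distk_ball _ nk); last by apply/eqP; rewrite -[_ == _]negbK H.
  exact: leq_ltn_trans (card_gV_gt3 a0).
have [f fS] : exists f, forall i, leaf i (f i) \in S.
  exists (fun i => leaf i true \in S) => i; have [[] H1] := leafS i; first by rewrite H1.
  by case: (boolP (leaf i true \in S)).
have [g gS] : exists g, forall i, side i (g i) \in S.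
  exists (fun i => side i true \in S) => i; have [[] H1] := sideS i; first by rewrite H1.
  by case: (boolP (side i true \in S)).
have c0 : (u == c) = (w == c) by have := H c 0 cS isT; rewrite !inE.
have hubH n : 0 < n <= 2 -> (u \in ball e n hub) = (w \in ball e n hub).
  move=> /andP[n0 n2]; case: ck => [ch|[cz kk]].
    by rewrite -ch H // (leq_trans n2).
  (* The hub is the only neighbour of the pendant, so the pendant sees the balls of the hub with one
     unit of delay. Radius 2 at the hub thus costs radius 3, whence [2 < k]. *)
  have hz x : (x \in ball e n hub) = (x \in ball e n.+1 pendant).
    rewrite ballS_pendant; case: eqVneq => // ->; apply: (ball_leq n0).
    by rewrite ball1_hubE.
  by rewrite !hz -cz H // (leq_trans _ kk).
apply/eqP; apply: (decode (f := f) (g := g) _ c0 hubH) => [|i n n2|i n n2].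
- by case: ck => [|[]] ->; rewrite !inE eqxx ?orbT.
- by rewrite H // (leq_trans n2).
- by rewrite H // (leq_trans n2).
Qed.

(** Maker's pairing: twins with each other, hub with pendant; spines and apexes are fixed, hence
    unpaired. *)
Definition mate u : T :=
  match u with
  | inl (i, t) => inl (i, inord (nth 0 [:: 0; 2; 1; 4; 3; 5] t))
  | inr b => inr (~~ b)
  end.

Lemma mateE :
  ((forall i, mate (spine i) = spine i) *
   (forall i b, mate (leaf i b) = leaf i (~~ b)) *
   (forall i b, mate (side i b) = side i (~~ b)) *
   (forall i, mate (apex i) = apex i) *
   (mate hub = pendant) * (mate pendant = hub))%type.
Proof.
by do !split; intros => //; try case: b; congr (inl (_, _)); apply: val_inj; rewrite /= inordK.
Qed.

Lemma mateK : involutive mate.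
Proof. by elim/gV_ind => *; rewrite !mateE ?negbK. Qed.

Lemma pairing_resolving c k S : 0 < alpha ->
  2 <= k -> (c = hub) \/ (c = pendant) /\ 2 < k -> c \in S ->
  (forall v, mate v != v -> (v \in S) || (mate v \in S)) -> resolving e k S.
Proof.
move=> a0 k2 ck cS pS; apply: resolving_transversal a0 k2 ck cS _ _ => i.
  have := pS (leaf i true); rewrite mateE gV_eqE andbF => /(_ isT)/orP[] H;
    by [exists true | exists false].
have := pS (side i true); rewrite mateE gV_eqE andbF => /(_ isT)/orP[] H;
  by [exists true | exists false].
Qed.

(** Opening with the hub secures an observer that suffices already at level 2; the twin pairs supply
    the rest. *)
Lemma maker_first_wins_ge2 k : 0 < alpha -> 2 <= k -> win e k true set0 set0.
Proof.
move=> a0 k2; rewrite (@win_maker _ _ _ _ _ hub) ?inE //; apply/existsP; exists hub.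
rewrite !inE /=; apply: (pairing_strategy (p := mate) (M0 := [set hub])).
- exact: mateK.
- by move=> S; rewrite sub1set => hS; apply: pairing_resolving a0 k2 _ hS; left.
- exact: subsetUl.
- by move=> v _; rewrite inE.
Qed.

(** The pair of hub and pendant yields one of them, and from level 3 on either will do. *)
Lemma maker_second_wins_ge3 k : 0 < alpha -> 2 < k -> win e k false set0 set0.
Proof.
move=> a0 k3; apply: (pairing_strategy (p := mate) (M0 := set0)).
- exact: mateK.
- move=> S _ pS; have := pS hub; rewrite mateE gV_eqE => /(_ isT)/orP[] hS.
    by apply: pairing_resolving a0 (ltnW k3) _ hS pS; left.
  by apply: pairing_resolving a0 (ltnW k3) _ hS pS; right.
- exact: sub0set.
- by move=> v _; rewrite inE.
Qed.

End GadgetGraph.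

Theorem theorem2p13 :
  (* (a) *)
  (exists (T : finType) (e : rel T), 0 < #|T| /\ simple_connected_graph e /\
     forall k, 0 < k -> O_R e k = OM) /\
  (* (b) *)
  (exists (T : finType) (e : rel T), 0 < #|T| /\ simple_connected_graph e /\
     forall k, 0 < k -> O_R e k = ON) /\
  (* (c) *)
  (exists (T : finType) (e : rel T), 0 < #|T| /\ simple_connected_graph e /\
     forall k, 0 < k -> O_R e k = OB) /\
  (* (d) *)
  (exists (T : finType) (e : rel T), 0 < #|T| /\ simple_connected_graph e /\
     O_R e 1 = ON /\ forall k, 2 <= k -> O_R e k = OM) /\
  (* (e) *)
  (exists (T : finType) (e : rel T), 0 < #|T| /\ simple_connected_graph e /\
     O_R e 1 = OB /\ forall k, 2 <= k -> O_R e k = ON) /\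
  (* (f) *)
  (exists (T : finType) (e : rel T), 0 < #|T| /\ simple_connected_graph e /\
     O_R e 1 = OB /\ forall k, 2 <= k -> O_R e k = OM) /\
  (* (g) *)
  (forall alpha : nat, 2 <= alpha ->
     simple_connected_graph (@g_adj alpha) /\
     O_R (@g_adj alpha) 1 = OB /\ O_R (@g_adj alpha) 2 = ON /\
     forall k, 3 <= k -> O_R (@g_adj alpha) k = OM) /\
  (exists (T : finType) (e : rel T), 0 < #|T| /\ simple_connected_graph e /\
     O_R e 1 = OB /\ O_R e 2 = ON /\ forall k, 3 <= k -> O_R e k = OM).
Proof.
have a1 alpha : 2 <= alpha -> 0 < alpha by apply: ltnW.
have partG alpha : 2 <= alpha ->
     simple_connected_graph (@g_adj alpha) /\
     O_R (@g_adj alpha) 1 = OB /\ O_R (@g_adj alpha) 2 = ON /\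
     forall k, 3 <= k -> O_R (@g_adj alpha) k = OM.
  move=> a2; split; first exact: g_connected.
  split; first exact: breaker_wins_1.
  split=> [|k k3]; rewrite /O_R maker_first_winsE maker_second_winsE.
    by rewrite maker_first_wins_ge2 ?a1 // (negPf (breaker_first_wins_2 a2)).
  by rewrite maker_first_wins_ge2 ?maker_second_wins_ge3 ?a1 // ltnW.
split; [|split; [|split; [|split; [|split; [|split; [|split]]]]]].
- exists 'I_3, path3; rewrite card_ord; split=> //; split.
    by apply: (edge_rel_graph (d := 2)); vm_compute.
  (* The diameter is at most 2, so evaluating level 1 settles every positive [k]. *)
  by move=> k; apply: (@O_R_edge_rel_diam _ _ 1); vm_compute.
- exists 'I_3, triangle; rewrite card_ord; split=> //; split.
    by apply: (edge_rel_graph (d := 2)); vm_compute.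
  by move=> k; apply: (@O_R_edge_rel_diam _ _ 1); vm_compute.
- exists 'I_4, complete4; rewrite card_ord; split=> //; split.
    by apply: (edge_rel_graph (d := 2)); vm_compute.
  by move=> k; apply: (@O_R_edge_rel_diam _ _ 1); vm_compute.
- exists 'I_5, bull; rewrite card_ord; split=> //; split.
    by apply: (edge_rel_graph (d := 3)); vm_compute.
  (* Here the diameter is at most 3: level 1 is evaluated separately, and level 2 settles all
     [k >= 2]. *)
  split; first by rewrite O_R_edge_rel //; vm_compute.
  by move=> k; apply: (@O_R_edge_rel_diam _ _ 2); vm_compute.
- exists 'I_8, triangle_3_2_leaves; rewrite card_ord; split=> //; split.
    by apply: (edge_rel_graph (d := 3)); vm_compute.
  split; first by rewrite O_R_edge_rel //; vm_compute.
  by move=> k; apply: (@O_R_edge_rel_diam _ _ 2); vm_compute.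
- exists 'I_8, diamond_2_2_leaves; rewrite card_ord; split=> //; split.
    by apply: (edge_rel_graph (d := 3)); vm_compute.
  split; first by rewrite O_R_edge_rel //; vm_compute.
  by move=> k; apply: (@O_R_edge_rel_diam _ _ 2); vm_compute.
- exact: partG.
- exists (gV 2), (@g_adj 2); have [? ?] := partG 2 isT; split=> //.
  exact: leq_ltn_trans (card_gV_gt3 _).
Qed.
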